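(* Let $\alpha\in[0,1]$. There exists a constant $f(\alpha)>0$ such that for all $u=(u_1,u_2,u_3)$ and $v=(v_1,v_2,v_3)$ in $\mathbb{R}^3$, $$\|u+v\|_\alpha\ \le\ \|u\|_\alpha+\|v\|_\alpha+f(\alpha)\,|u_2v_3+u_3v_2| .$$
   Context: For $\alpha\in[0,1]$ and $w=(w_1,w_2,w_3)\in\mathbb{R}^3$, $\|w\|_\alpha=\sqrt{w_1^2+w_2^2+w_3^2-2(1-\alpha)w_2w_3}$. *)

(* Defs.v *)
From mathcomp Require Import all_boot all_order all_algebra.
From mathcomp Require Import reals.

Set Implicit Arguments.
Unset Strict Implicit.
Unset Printing Implicit Defensive.

Import Order.TTheory GRing.Theory Num.Theory.

Local Open Scope ring_scope.

(* The coordinates w_1, w_2, w_3 are [w 0 0], [w 0 1], [w 0 2], the column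
   indices being numerals of the ring 'I_3. For 0 <= alpha <= 1 the radicand
   is nonnegative, so the value 0 of [Num.sqrt] on negatives is not used. *)
Definition alpha_norm (R : realType) (alpha : R) (w : 'rV[R]_3) : R :=
  Num.sqrt (w 0 0 ^+ 2 + w 0 1 ^+ 2 + w 0 2 ^+ 2
            - 2 * (1 - alpha) * w 0 1 * w 0 2).

(* Main.v *)
Require Import Defs.
From mathcomp Require Import all_boot all_order all_algebra.
From mathcomp Require Import reals.
From mathcomp Require Import ring lra.

(** For [0 <= alpha <= 1] the quadratic form under the root is positive
    semidefinite: with [c := 1 - alpha] it equals
    [w_1 ^+ 2 + (w_2 - c * w_3) ^+ 2 + (1 - c ^+ 2) * w_3 ^+ 2], and
    [c ^+ 2 <= 1]. Hence [alpha_norm alpha] is a seminorm and satisfies the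
    plain triangle inequality ([ler_alpha_normD]), so that any positive constant
    can be put in front of the nonnegative correction term. The triangle
    inequality follows as usual from Cauchy-Schwarz for the associated bilinear
    form ([alpha_form_cauchy_schwarz]), which is proved by a weighted Lagrange
    identity and therefore also covers the degenerate form at [alpha = 0]. *)

Set Implicit Arguments.
Unset Strict Implicit.
Unset Printing Implicit Defensive.

Import Order.TTheory GRing.Theory Num.Theory.

Local Open Scope ring_scope.

Definition alpha_form (R : realType) (alpha : R) (u v : 'rV[R]_3) : R :=
  u 0 0 * v 0 0 + u 0 1 * v 0 1 + u 0 2 * v 0 2
  - (1 - alpha) * (u 0 1 * v 0 2 + u 0 2 * v 0 1).

Lemma alpha_normE (R : realType) (alpha : R) (w : 'rV[R]_3) :
  alpha_norm alpha w = Num.sqrt (alpha_form alpha w w).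
Proof. by rewrite /alpha_norm /alpha_form; congr Num.sqrt; ring. Qed.

Lemma alpha_formDD (R : realType) (alpha : R) (u v : 'rV[R]_3) :
  alpha_form alpha (u + v) (u + v) =
  alpha_form alpha u u + 2 * alpha_form alpha u v + alpha_form alpha v v.
Proof. by rewrite /alpha_form !mxE; ring. Qed.

Lemma weight_ge0 (R : realType) (alpha : R) :
  0 <= alpha <= 1 -> 0 <= 1 - (1 - alpha) ^+ 2.
Proof. move=> /andP[a0 a1].
have -> : 1 - (1 - alpha) ^+ 2 = alpha * (2 - alpha) by ring.
by apply: mulr_ge0 => //; lra. Qed.

Lemma alpha_form_ge0 (R : realType) (alpha : R) (w : 'rV[R]_3) :
  0 <= alpha <= 1 -> 0 <= alpha_form alpha w w.
Proof.
move=> /weight_ge0 k0; set c := 1 - alpha in k0.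
have -> : alpha_form alpha w w =
    w 0 0 ^+ 2 + (w 0 1 - c * w 0 2) ^+ 2 + (1 - c ^+ 2) * w 0 2 ^+ 2.
  by rewrite /alpha_form /c; ring.
by do ![exact: k0 | apply: sqr_ge0 | apply: addr_ge0 | apply: mulr_ge0].
Qed.

(** In the coordinates [w_1], [w_2 - c * w_3], [w_3] the form is diagonal with
    weights 1, 1 and [1 - c ^+ 2]; the defect of Cauchy-Schwarz is then the sum
    of the squared 2 x 2 minors, each weighted by the product of the two weights
    involved. *)
Lemma alpha_form_cauchy_schwarz (R : realType) (alpha : R) (u v : 'rV[R]_3) :
  0 <= alpha <= 1 ->
  alpha_form alpha u v ^+ 2 <= alpha_form alpha u u * alpha_form alpha v v.
Proof.
move=> /weight_ge0 k0; set c := 1 - alpha in k0.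
rewrite -subr_ge0.
have -> : alpha_form alpha u u * alpha_form alpha v v
          - alpha_form alpha u v ^+ 2 =
    (u 0 0 * (v 0 1 - c * v 0 2) - (u 0 1 - c * u 0 2) * v 0 0) ^+ 2
    + (1 - c ^+ 2) * (u 0 0 * v 0 2 - u 0 2 * v 0 0) ^+ 2
    + (1 - c ^+ 2) * ((u 0 1 - c * u 0 2) * v 0 2
                      - u 0 2 * (v 0 1 - c * v 0 2)) ^+ 2.
  by rewrite /alpha_form /c; ring.
by do ![exact: k0 | apply: sqr_ge0 | apply: addr_ge0 | apply: mulr_ge0].
Qed.

Lemma ler_alpha_normD (R : realType) (alpha : R) (u v : 'rV[R]_3) :
  0 <= alpha <= 1 ->
  alpha_norm alpha (u + v) <= alpha_norm alpha u + alpha_norm alpha v.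
Proof.
move=> ha; rewrite !alpha_normE.
have uv_le : alpha_form alpha u v <=
    Num.sqrt (alpha_form alpha u u) * Num.sqrt (alpha_form alpha v v).
  rewrite -sqrtrM ?alpha_form_ge0 //.
  apply: le_trans (ler_norm _) _; rewrite -sqrtr_sqr.
  exact/ler_wsqrtr/alpha_form_cauchy_schwarz.
rewrite -[leRHS]ger0_norm ?addr_ge0 ?sqrtr_ge0 // -sqrtr_sqr.
apply: ler_wsqrtr; rewrite alpha_formDD sqrrD !sqr_sqrtr ?alpha_form_ge0 //.
by rewrite lerD2r lerD2l mulr_natl lerMn2r.
Qed.

Theorem mainTheorem5 (R : realType) (alpha : R) (halpha : 0 <= alpha <= 1) :
  exists f : R, 0 < f /\
    forall u v : 'rV[R]_3,
      alpha_norm alpha (u + v) <=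
        alpha_norm alpha u + alpha_norm alpha v
        + f * `|u 0 1 * v 0 2 + u 0 2 * v 0 1|.
Proof.
exists 1; split=> // u v; rewrite mul1r.
by apply: le_trans (ler_alpha_normD u v halpha) _; rewrite lerDl.
Qed.
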